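(* Let $G(s)=C(sI-A)^{-1}B+D$ be a SISO (scalar) proper real rational transfer function with minimal state space realization $(A,B,C,D)$, where $A\in\mathbb{R}^{n\times n}$, $B\in\mathbb{R}^{n\times 1}$, $C\in\mathbb{R}^{1\times n}$, $D\in\mathbb{R}$. If $G(s)$ is negative imaginary, then for every $\epsilon\ge 0$ the perturbed transfer function $$G_\epsilon(s)=C\,(sI-(A-\epsilon I))^{-1}B+D,$$ with state space realization $(A-\epsilon I,B,C,D)$, is negative imaginary.
   Context: Here $j=\sqrt{-1}$ and $^*$ denotes the complex conjugate transpose. Definition (negative imaginary, NI). A square real rational transfer function matrix $G(s)$ is negative imaginary (NI) if: (1) $G(s)$ has no pole in $\mathrm{Re}[s]>0$; (2) for all $\omega\ge 0$ such that $j\omega$ is not a pole of $G(s)$, $j(G(j\omega)-G(j\omega)^* )\ge 0$ (Hermitian positive semidefinite); (3) if $s=j\omega_0$ with $\omega_0>0$ is a pole of $G(s)$, then it is a simple pole and the matrix $K_0=\lim_{s\to j\omega_0}(s-j\omega_0)\,jG(s)$ is Hermitian positive semidefinite; (4) if $s=0$ is a pole of $G(s)$, then it is either a simple pole or a double pole, and if it is a double pole then $\lim_{s\to 0}s^2G(s)\ge 0$. *)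

(* Defs.v *)
From HB Require Import structures.
From mathcomp Require Import all_boot all_order all_algebra complex.
From mathcomp Require Import all_classical all_reals all_analysis.
Set Implicit Arguments.
Unset Strict Implicit.
Unset Printing Implicit Defensive.
Import Order.TTheory GRing.Theory Num.Theory.
Import numFieldNormedType.Exports.
Local Open Scope classical_set_scope.
Local Open Scope ring_scope.
Local Open Scope complex_scope.
Local Open Scope sesquilinear_scope.

(* R[i] packed as a numClosedFieldType: the normed topology of
   numFieldNormedType is only inferred from the structure, not from the
   concrete type R[i]. *)
Definition Cplx (R : realType) : numClosedFieldType := R[i].

Definition toCplx {R : realType} (x : R) : Cplx R := x%:C.
HB.instance Definition _ (R : realType) :=
  GRing.RMorphism.copy (@toCplx R) (real_complex R).

(* In particular j = jw 1. *)
Definition jw {R : realType} (w : R) : Cplx R := 0 +i* w.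

Definition psdmx {C : numClosedFieldType} {m : nat} (M : 'M[C]_m) : Prop :=
  M ^t* = M /\ forall x : 'cV[C]_m, 0 <= (x ^t* *m M *m x) 0 0.

Section Rational.
Variable R : realType.
Implicit Types (f : {fraction {poly R}}) (s : Cplx R).

(* [frac (repr f)] is an arbitrary (numerator, denominator) pair of the fraction
   [f]; dividing by the gcd gives a coprime pair, unique up to a common nonzero
   constant. *)
Definition rnum f : {poly R} :=
  (frac (repr f)).1 %/ gcdp (frac (repr f)).1 (frac (repr f)).2.
Definition rden f : {poly R} :=
  (frac (repr f)).2 %/ gcdp (frac (repr f)).1 (frac (repr f)).2.

(* Meaningful only when [s] is not a pole of [f]. *)
Definition reval f s : Cplx R :=
  (map_poly toCplx (rnum f)).[s] / (map_poly toCplx (rden f)).[s].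

(* Equal to 0 when [s] is not a pole of [f]. *)
Definition rpole_order f s : nat := mup s (map_poly toCplx (rden f)).

End Rational.

Section TransferMatrix.
Variables (R : realType) (m : nat).
Implicit Types (G : 'M[{fraction {poly R}}]_m) (s : Cplx R).

Definition tf_eval G s : 'M[Cplx R]_m := map_mx (fun f => reval f s) G.

(* [s] is a pole of order k of a matrix function when k is the largest order of
   [s] as a pole of an entry: (z - s)^k G(z) has a finite nonzero limit at s. *)
Definition pole_order G s : nat :=
  (\max_(i < m) \max_(j < m) rpole_order (G i j) s)%N.

Definition is_pole G s : Prop := (0 < pole_order G s)%N.

Definition negative_imaginary G : Prop :=
  [/\ forall s, 0 < complex.Re s -> ~ is_pole G s,
      forall w : R, 0 <= w -> ~ is_pole G (jw w) ->
        psdmx (jw 1 *: (tf_eval G (jw w) - (tf_eval G (jw w)) ^t*)),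
      forall w0 : R, 0 < w0 -> is_pole G (jw w0) ->
        pole_order G (jw w0) = 1%N /\
        exists2 K0 : 'M[Cplx R]_m,
          (s - jw w0) *: (jw 1 *: tf_eval G s) @[s --> (jw w0)^'] --> K0 &
          psdmx K0
    & is_pole G 0 ->
        (pole_order G 0 = 1%N \/ pole_order G 0 = 2%N) /\
        (pole_order G 0 = 2%N ->
         exists2 K : 'M[Cplx R]_m,
           s ^+ 2 *: tf_eval G s @[s --> (0 : Cplx R)^'] --> K &
           psdmx K)].

End TransferMatrix.

Section StateSpace.
Variable R : realType.

Definition rat_const (a : R) : {fraction {poly R}} := tofrac a%:P.

(* C (sI - A)^-1 B + D, with m inputs and p outputs, as a matrix of rational
   functions in the indeterminate s = 'X.  The matrix sI - A is invertible over
   the field of fractions since its determinant is the characteristic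
   polynomial of A. *)
Definition transfer_function (n m p : nat) (A : 'M[R]_n) (B : 'M[R]_(n, m))
    (C : 'M[R]_(p, n)) (D : 'M[R]_(p, m)) : 'M[{fraction {poly R}}]_(p, m) :=
  map_mx rat_const C *m invmx ((tofrac 'X)%:M - map_mx rat_const A)
    *m map_mx rat_const B + map_mx rat_const D.

Definition realization (m p : nat) (G : 'M[{fraction {poly R}}]_(p, m))
    (n : nat) (A : 'M[R]_n) (B : 'M[R]_(n, m))
    (C : 'M[R]_(p, n)) (D : 'M[R]_(p, m)) : Prop :=
  G = transfer_function A B C D.

Definition minimal_realization (m p : nat) (G : 'M[{fraction {poly R}}]_(p, m))
    (n : nat) (A : 'M[R]_n) (B : 'M[R]_(n, m))
    (C : 'M[R]_(p, n)) (D : 'M[R]_(p, m)) : Prop :=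
  realization G A B C D /\
  forall (n' : nat) (A' : 'M[R]_n') (B' : 'M[R]_(n', m))
    (C' : 'M[R]_(p, n')) (D' : 'M[R]_(p, m)),
    realization G A' B' C' D' -> (n <= n')%N.

End StateSpace.

(* Main.v *)
Require Import Defs.
From HB Require Import structures.
From mathcomp Require Import all_boot all_order all_algebra.
From mathcomp Require Import all_classical all_reals all_analysis.
From mathcomp Require Import complex ring lra zify.
Import Order.TTheory GRing.Theory Num.Theory.
Import numFieldNormedType.Exports.
Local Open Scope ring_scope.
Local Open Scope classical_set_scope.
Set Implicit Arguments.
Unset Strict Implicit.
Unset Printing Implicit Defensive.

(** The resolvent of [A - eps I] at [s] is that of [A] at [s + eps], so the
    perturbed transfer function is [G(s + eps)].  For [eps > 0] the closed right
    half plane is moved into the open one, where [G] has no pole; the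
    conditions on imaginary poles become vacuous, and what is left is
    [Im G <= 0] at the points [eps + jw] with [w >= 0].  This is a maximum principle:
    a negative imaginary [G] satisfies [Im G <= 0] on the whole closed first
    quadrant ([ni_quadrant_le0]), because [Im G <= 0] on its boundary, [G]
    is real at infinity, and the pole conditions forbid [Im G] to be large and
    positive near a pole.

    The maximum principle is obtained by following roots instead of maximising
    a function.  Write [G = p / q] and suppose that [G(z) = v] for some [z] in the
    quadrant, with [Im v > 0].  Let [T] be the set of [t >= 0] such that [v + jt]
    is a value of [G] on the quadrant, that is, such that the polynomial
    [p - (v + jt) q] has a root there.
    - [T] is bounded ([pole_avoids_ray], [ni_pole_avoids_ray]): for large [t] a
      root is close to a pole [z0] of [G], and then [t (s - z0)^k] is close to
      [-j] times the leading coefficient of the pole.  The conditions of the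
      definition put this number in an open half plane that [t (s - z0)^k]
      avoids when [s] is in the quadrant.
    - [T] contains its supremum: the roots of a polynomial lie near those of a nearby
      polynomial ([roots_near]), and the quadrant is closed.
    - [T] is open to the right ([root_persists]): a root at which
      [Im G > 0] is not on the boundary of the quadrant, so that it stays in the quadrant
      when [t] increases a little.

    So [T] is empty ([quadrant_avoids_upper_value]).  Both facts on roots are
    uniform over the plane, including a neighbourhood of infinity, because the
    polynomials have the same degree and [v + jt] is never the real value
    of [G] at infinity. *)

(** * Perturbation of the roots of a complex polynomial *)

Section Roots.
Variable C : numClosedFieldType.
Implicit Types (P H : {poly C}) (z r e : C) (rs : seq C).

Lemma norm_horner_le P (n : nat) z b : (size P <= n.+1)%N -> 1 <= b -> `|z| <= b ->
  `|P.[z]| <= (\sum_(i < size P) `|P`_i|) * b ^+ n.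
Proof.
move=> sP b1 zb; rewrite horner_coef mulr_suml.
apply: le_trans (ler_norm_sum _ _ _) _; apply: ler_sum => i _.
rewrite normrM normrX ler_wpM2l //.
have b0 : 0 <= b by apply: le_trans b1.
apply: (@le_trans _ _ (b ^+ i)); first by apply: lerXn2r; rewrite ?nnegrE.
by rewrite ler_weXn2l // -ltnS; apply: leq_trans sP.
Qed.

Lemma horner_prod_XsubC rs z : (\prod_(r <- rs) ('X - r%:P)).[z] = \prod_(r <- rs) (z - r).
Proof. by rewrite horner_prod; apply: eq_bigr => r _; rewrite hornerXsubC. Qed.

(** Away from the points of [rs], the product of the distances to them dominates
    [(1 + |z|)^n], uniformly in [z]: [1 + |z| <= |z - r| + (1 + |r|)], and
    the last summand is at most [(1 + |r|) / e] times [|z - r|].  This covers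
    bounded and unbounded [z] together. *)
Lemma norm_horner_le_prod P rs e z : 0 < e ->
  (size P <= (size rs).+1)%N -> {in rs, forall r, e <= `|z - r|} ->
  `|P.[z]| <= (\sum_(i < size P) `|P`_i|) * (\prod_(r <- rs) (1 + (1 + `|r|) / e))
     * \prod_(r <- rs) `|z - r|.
Proof.
move=> e0 sP ers.
apply: le_trans (@norm_horner_le _ _ z (1 + `|z|) sP _ _) _; rewrite ?lerDl ?lerDr //.
rewrite -mulrA ler_wpM2l ?sumr_ge0 // -big_split /=.
elim: rs ers {sP} => [|r rs IH] ers; first by rewrite big_nil expr0.
rewrite big_cons exprS ler_pM ?exprn_ge0 ?addr_ge0 //; last first.
  by apply: IH => s srs; apply: ers; rewrite inE srs orbT.
have er : e <= `|z - r| by apply: ers; rewrite inE eqxx.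
rewrite mulrDl mul1r addrC.
apply: (@le_trans _ _ (`|z - r| + (`|r| + 1))).
  by rewrite addrA lerD2r -{1}(subrK r z) ler_normD.
rewrite lerD2l addrC -mulrA ler_peMr ?addr_ge0 //.
by rewrite mulrC ler_pdivlMr // mul1r.
Qed.

Lemma uniform_near_seq (T : Type) (F : set_system T) {FF : Filter F}
    (good : T -> C -> Prop) rs :
  {in rs, forall r, \forall z \near r & t \near F, good t z} ->
  exists2 e : C, 0 < e & \forall t \near F, {in rs, forall r z, `|z - r| < e -> good t z}.
Proof.
elim: rs => [_|r rs IH grs]; first by exists 1 => //; near=> t.
have [e e0 he] : exists2 e : C, 0 < e &
    \forall t \near F, {in rs, forall r z, `|z - r| < e -> good t z}.
  by apply: IH => s srs; apply: grs; rewrite inE srs orbT.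
have /grs[[U V]/= [/nbhs_normP[e' /= e'0 hU] FV] UV] : r \in r :: rs by rewrite inE eqxx.
have cmp : e >=< e' by apply: real_comparable; apply: gtr0_real.
have m0 : 0 < Num.min e e' by rewrite comparable_lt_min // e0.
exists (Num.min e e') => //.
have emin z : `|z| < Num.min e e' -> `|z| < e /\ `|z| < e'.
  by rewrite comparable_lt_min // => /andP[].
near=> t; move=> s; rewrite inE => /predU1P[->|srs] z /emin[ze ze'].
  apply: (UV (z, t)); split => /=; first by apply: hU; rewrite /= distrC.
  by near: t.
by move: s srs z ze {ze'}; near: t; exact: he.
Unshelve. all: by end_near. Qed.

(** Every root of [P + d t H], wherever it lies, is close to a root of [P]
    once [d t] is small; hence a property that holds near each root of [P]
    holds at all roots of the perturbed polynomials.  A root [z] at distance at least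
    [e] from all roots of [P] would satisfy
    [|P(z)| = |d t| |H(z)| <= |d t| K prod |z - r|], while [|P(z)|] is
    [|lead_coef P| prod |z - r|]. *)
Lemma roots_near (T : Type) (F : set_system T) {FF : Filter F}
    P H (d : T -> C) (good : T -> C -> Prop) :
  P != 0 -> (size H <= size P)%N ->
  (forall e, 0 < e -> \forall t \near F, `|d t| < e) ->
  (forall r, root P r ->
     \forall z \near r & t \near F, root (P + d t *: H) z -> good t z) ->
  \forall t \near F, forall z, root (P + d t *: H) z -> good t z.
Proof.
move=> P0 sHP d0 gP.
have [rs Prs] := closed_field_poly_normal P.
have lP0 : lead_coef P != 0 by rewrite lead_coef_eq0.
have srs : size P = (size rs).+1 by rewrite Prs size_scale // size_prod_XsubC.
have [|e e0 he] := @uniform_near_seq T F FF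
  (fun t z => root (P + d t *: H) z -> good t z) rs.
  move=> r rrs; apply: gP.
  by rewrite Prs rootE hornerZ horner_prod_XsubC mulf_eq0 prodf_seq_eq0; apply/orP; right;
    apply/hasP; exists r; rewrite //= subrr.
pose K := (\sum_(i < size H) `|H`_i|) * (\prod_(r <- rs) (1 + (1 + `|r|) / e)).
have K0 : 0 <= K.
  rewrite mulr_ge0 ?sumr_ge0 ?prodr_ge0 // => r _.
  by rewrite addr_ge0 // divr_ge0 ?addr_ge0 // ltW.
have lK : 0 < `|lead_coef P| / (1 + K).
  by rewrite divr_gt0 ?normr_gt0 // ltr_pwDl.
near=> t.
have het : {in rs, forall r z, `|z - r| < e -> root (P + d t *: H) z -> good t z}.
  by near: t.
have dt : `|d t| < `|lead_coef P| / (1 + K) by near: t; exact: d0.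
move=> z rz; case: (boolP (has (fun r => `|z - r| < e) rs)) => [/hasP[r rrs zr]|].
  exact: (het r).
move=> /hasPn far.
have efar : {in rs, forall r, e <= `|z - r|}.
  by move=> r /far /=; rewrite -real_leNgt ?normr_real ?gtr0_real.
have := @norm_horner_le_prod H rs e z e0 _ efar; rewrite -srs => /(_ sHP).
rewrite -/K; set Z := \prod_(r <- rs) _ => hHz.
have Z0 : 0 < Z.
  rewrite /Z big_seq; apply: prodr_gt0 => r rrs; exact: lt_le_trans (efar r rrs).
have : `|P.[z]| = `|d t| * `|H.[z]|.
  by move: rz; rewrite rootE !hornerE addr_eq0 => /eqP ->; rewrite normrN normrM.
rewrite Prs hornerZ horner_prod_XsubC normrM normr_prod -/Z => eqZ.
suff : `|lead_coef P| * Z < `|lead_coef P| * Z by rewrite ltxx.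
rewrite {1}eqZ; apply: (@le_lt_trans _ _ (`|d t| * (1 + K) * Z)).
  rewrite -mulrA ler_wpM2l //; apply: le_trans hHz _.
  by rewrite ler_wpM2r ?ltW // ltrDr.
by rewrite ltr_pM2r // -ltr_pdivlMr // ltr_pwDl.
Unshelve. all: by end_near. Qed.

(** Conversely a root of [P] is close to a root of [P + d t H]: the value of the
    perturbed polynomial at [z] tends to 0, and it is its leading coefficient,
    which stays away from 0, times the product of the distances from [z] to
    its [m] roots. *)
Lemma root_persists (T : Type) (F : set_system T) {FF : Filter F}
    P H (d : T -> C) z e :
  P != 0 -> (size H <= size P)%N ->
  (forall e, 0 < e -> \forall t \near F, `|d t| < e) ->
  root P z -> 0 < e ->
  \forall t \near F, exists2 w, root (P + d t *: H) w & `|w - z| < e.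
Proof.
move=> P0 sHP d0 Pz e0.
have lP0 : lead_coef P != 0 by rewrite lead_coef_eq0.
pose m := (size P).-1.
have sP : size P = m.+1 by rewrite prednK // size_poly_gt0.
have l2 : 0 < `|lead_coef P| / 2 by rewrite divr_gt0 ?normr_gt0.
near=> t.
have d1 : `|d t| * `|H`_m| < `|lead_coef P| / 2.
  have K0 : 0 < 1 + `|H`_m| by rewrite ltr_pwDl.
  apply: (@le_lt_trans _ _ (`|d t| * (1 + `|H`_m|))).
    by rewrite ler_wpM2l // lerDr.
  by rewrite -ltr_pdivlMr //; near: t; apply: d0; rewrite divr_gt0.
have d2 : `|d t| * `|H.[z]| < `|lead_coef P| / 2 * e ^+ m.
  have K0 : 0 < 1 + `|H.[z]| by rewrite ltr_pwDl.
  apply: (@le_lt_trans _ _ (`|d t| * (1 + `|H.[z]|))).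
    by rewrite ler_wpM2l // lerDr.
  by rewrite -ltr_pdivlMr //; near: t; apply: d0; rewrite divr_gt0 // mulr_gt0 // exprn_gt0.
set Pt := P + d t *: H.
have ltE : Pt`_m = lead_coef P + d t * H`_m by rewrite coefD coefZ.
have lt_ge : `|lead_coef P| / 2 < `|Pt`_m|.
  rewrite ltE; apply: lt_le_trans (lerB_normD _ _). 
  by rewrite normrM ltrBrDr [ltRHS]splitr ltrD2l.
have sPt : size Pt = m.+1.
  apply/eqP; rewrite eqn_leq; apply/andP; split.
    rewrite (leq_trans (size_polyD _ _)) // geq_max sP leqnn /=.
    by rewrite (leq_trans (size_scale_leq _ _)) // -sP.
  by rewrite ltnNge; apply/negP => /leq_sizeP/(_ m (leqnn m)) E; move: lt_ge; rewrite E normr0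
    => /(lt_trans l2); rewrite ltxx.
have lPt : lead_coef Pt = Pt`_m by rewrite lead_coefE sPt.
have lPt0 : lead_coef Pt != 0 by rewrite lead_coef_eq0 -size_poly_eq0 sPt.
have [rs Prs] := closed_field_poly_normal Pt.
have srs : size rs = m by apply/eqP; rewrite -eqSS -sPt Prs size_scale // size_prod_XsubC.
case: (boolP (has (fun r => `|r - z| < e) rs)) => [/hasP[r rrs zr]|].
  exists r => //; rewrite -/Pt Prs rootE hornerZ horner_prod_XsubC mulf_eq0 prodf_seq_eq0.
  by apply/orP; right; apply/hasP; exists r; rewrite //= subrr.
move=> /hasPn far; exfalso.
have : `|Pt.[z]| = `|d t| * `|H.[z]|.
  by rewrite !hornerE (eqP (Pz : P.[z] == 0)) add0r normrM.
rewrite Prs hornerZ horner_prod_XsubC normrM normr_prod lPt => E.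
move: d2; rewrite -E => /lt_le_trans d2.
suff /d2 : `|lead_coef P| / 2 * e ^+ m <= `|Pt`_m| * \prod_(r <- rs) `|z - r| by rewrite ltxx.
rewrite ler_pM // ?exprn_ge0 ?(ltW e0) ?(ltW l2) ?(ltW lt_ge) // -srs.
elim: (rs) far => [|r l IH] far; first by rewrite big_nil expr0.
rewrite big_cons exprS ler_pM ?exprn_ge0 ?(ltW e0) //.
  by have := far r; rewrite inE eqxx distrC => /(_ isT) /=;
      rewrite -real_leNgt ?normr_real ?gtr0_real.
by apply: IH => s sl; apply: far; rewrite inE sl orbT.
Unshelve. all: by end_near. Qed.
End Roots.

(** * Topology of the complex plane and the first quadrant *)

Section Cont.
Variable C : numFieldType.
Lemma continuous_hornerC (p : {poly C}) : continuous (fun z => p.[z]).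
Proof.
elim/poly_ind: p => [|p c IH] z.
  rewrite (_ : horner 0 = fun=> 0); first exact: cst_continuous.
  by apply/funext => s; rewrite horner0.
rewrite (_ : horner (p * 'X + c%:P) = fun s => p.[s] * s + c); last first.
  by apply/funext => s; rewrite !hornerE.
apply: (@cvgD _ _ _ (nbhs z) (nbhs_filter z)); last exact: cvg_cst.
by apply: (@cvgM _ _ (nbhs z) (nbhs_filter z)); [exact: IH | exact: cvg_id].
Qed.

End Cont.

Section Quadrant.
Variable R : realType.
Implicit Types (z s v : Cplx R) (p q : {poly Cplx R}) (t : R).

Lemma Re_add z s : complex.Re (z + s) = complex.Re z + complex.Re s.
Proof. by case: z s => [a b] [c d]. Qed.
Lemma Im_add z s : complex.Im (z + s) = complex.Im z + complex.Im s.
Proof. by case: z s => [a b] [c d]. Qed.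
Lemma Re_opp z : complex.Re (- z) = - complex.Re z.
Proof. by case: z => a b. Qed.
Lemma Im_opp z : complex.Im (- z) = - complex.Im z.
Proof. by case: z => a b. Qed.
Lemma Re_mul z s : complex.Re (z * s) =
  complex.Re z * complex.Re s - complex.Im z * complex.Im s.
Proof. by case: z s => [a b] [c d]. Qed.
Lemma Im_mul z s : complex.Im (z * s) =
  complex.Re z * complex.Im s + complex.Im z * complex.Re s.
Proof. by case: z s => [a b] [c d]. Qed.

Lemma norm_toCplx t : `|toCplx t| = toCplx `|t|.
Proof. by rewrite /toCplx (@normc_def R) /= expr0n addr0 sqrtr_sqr. Qed.

Lemma norm_jw t : `|jw t| = toCplx `|t|.
Proof. by rewrite /toCplx (@normc_def R) /= expr0n add0r sqrtr_sqr. Qed.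

Lemma Cplx_gt0E (e : Cplx R) : 0 < e -> e = toCplx (complex.Re e) /\ 0 < complex.Re e.
Proof. by case: e => a b; rewrite ltcE /= => /andP[/eqP-> ->]. Qed.

Lemma ltr_toCplx t (t' : R) : (toCplx t < toCplx t') = (t < t').
Proof. by rewrite ltcE /= eqxx. Qed.

Lemma near_toCplx_dist z t : 0 < t -> \forall s \near z, `|z - s| < toCplx t.
Proof.
by rewrite -ltr_toCplx rmorph0 => t0; apply: (@cvgr_dist_lt _ _ _ (nbhs z) _ id).
Qed.

Lemma continuous_Re : continuous (fun z : Cplx R => complex.Re z).
Proof.
move=> z; apply/(@cvgrPdist_lt _ _ _ (nbhs z) (nbhs_filter z)) => e e0.
near=> s.
have h : `|z - s| < toCplx e by near: s; exact: near_toCplx_dist.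
have := le_lt_trans (normc_ge_Re (z - s)) h.
by rewrite ltr_toCplx -[_ - _]/(z + - s) Re_add Re_opp.
Unshelve. all: by end_near. Qed.

Lemma continuous_Im : continuous (fun z : Cplx R => complex.Im z).
Proof.
move=> z; apply/(@cvgrPdist_lt _ _ _ (nbhs z) (nbhs_filter z)) => e e0.
near=> s.
have h : `|jw 1 * (z - s)| < toCplx e.
  by rewrite normrM norm_jw normr1 rmorph1 mul1r; near: s; exact: near_toCplx_dist.
have := le_lt_trans (normc_ge_Re (jw 1 * (z - s))) h.
by rewrite Re_mul Im_add Im_opp /= mul0r sub0r mul1r normrN ltr_toCplx.
Unshelve. all: by end_near. Qed.

Lemma continuous_toCplx : continuous (@toCplx R : R -> Cplx R).
Proof.
move=> t; apply/cvgrPdist_lt => e /Cplx_gt0E[-> e0].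
near=> u; rewrite -rmorphB norm_toCplx ltr_toCplx.
by near: u; apply: (@cvgr_dist_lt _ _ _ (nbhs t) _ id).
Unshelve. all: by end_near. Qed.

Definition first_quadrant : set (Cplx R) := [set z | 0 <= complex.Re z /\ 0 <= complex.Im z].

Lemma near_notin_quadrant z : ~ first_quadrant z -> \forall s \near z, ~ first_quadrant s.
Proof.
move=> nz.
have [rz|rz] := ltP (complex.Re z) 0.
  near=> s; move=> [+ _]; apply/negP; rewrite -ltNge.
  by near: s; apply: (cvgr_lt (complex.Re z)) => //; exact: continuous_Re.
have [iz|iz] := ltP (complex.Im z) 0; last by case: nz.
near=> s; move=> [_]; apply/negP; rewrite -ltNge.
by near: s; apply: (cvgr_lt (complex.Im z)) => //; exact: continuous_Im.
Unshelve. all: by end_near. Qed.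

Lemma near_interior_quadrant z : 0 < complex.Re z -> 0 < complex.Im z ->
  \forall s \near z, first_quadrant s.
Proof.
move=> rz iz; near=> s; split; apply: ltW.
  by near: s; apply: (cvgr_gt (complex.Re z)) => //; exact: continuous_Re.
by near: s; apply: (cvgr_gt (complex.Im z)) => //; exact: continuous_Im.
Unshelve. all: by end_near. Qed.

(** For [p] and [q] without common root, its roots are the points where [p / q]
    takes the value [v + jt]. *)
Definition level_poly p q v t : {poly Cplx R} := p - (v + jw t) *: q.

Lemma root_level_poly p q v t z : root (level_poly p q v t) z = (p.[z] == (v + jw t) * q.[z]).
Proof. by rewrite rootE !hornerE subr_eq0. Qed.

Lemma jw_toCplx t : jw t = toCplx t * jw 1 :> Cplx R.
Proof. by apply/eqP; rewrite eq_complex /= mulr0 !mul0r mulr1 subr0 addr0 !eqxx. Qed.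

Lemma jw1_sq : jw 1 * jw 1 = -1 :> Cplx R.
Proof. by apply/eqP; rewrite eq_complex /= !mulr0 !mul0r mulr1 oppr0 addr0 sub0r !eqxx. Qed.

Lemma jw1_neq0 : jw 1 != 0 :> Cplx R.
Proof. by rewrite eq_complex /= oner_eq0 andbF. Qed.

Lemma jw1V : (jw 1)^-1 = - jw 1 :> Cplx R.
Proof. by apply: (mulfI jw1_neq0); rewrite mulfV ?jw1_neq0 // mulrN jw1_sq opprK. Qed.

(** Near a pole [z0] of order [k] of [p / q], a solution of [p / q = v + jt]
    satisfies [t (z - z0)^k = (p / E)(z) / (v / t + j)], which tends to [-j]
    times the leading coefficient of the pole as [z] tends to [z0] and [t] to
    infinity.  No such solution exists in the quadrant if this limit has a neighbourhood
    that [t (z - z0)^k] does not meet. *)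
Lemma pole_avoids_ray p q E (k : nat) v z0 (N : set (Cplx R)) :
  q = ('X - z0%:P) ^+ k * E ->
  E.[z0] != 0 -> nbhs (- jw 1 * (p.[z0] / E.[z0])) N ->
  (forall z t, first_quadrant z -> 0 < t -> ~ N (toCplx t * (z - z0) ^+ k)) ->
  \forall z \near z0 & t \near +oo, first_quadrant z ->
    p.[z] != (v + jw t) * q.[z].
Proof.
move=> -> E0 NN hN.
pose F : set_system (Cplx R * R) := filter_prod (nbhs z0) +oo.
have FF : Filter F by exact: filter_prod_filter.
have hornerF (f : {poly Cplx R}) : f.[zt.1] @[zt --> F] --> f.[z0].
  by apply: (cvg_comp fst (horner f) _ (@continuous_hornerC _ f z0)); exact: cvg_fst.
have cw : v * toCplx zt.2^-1 + jw 1 @[zt --> F] --> (jw 1 : Cplx R).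
  rewrite -[X in _ --> X]add0r -[X in _ --> X + _](mulr0 v) -(rmorph0 (@toCplx R)).
  apply: (@cvgD _ _ _ F FF); last exact: cvg_cst.
  apply: (@cvgM _ _ F FF); first exact: cvg_cst.
  apply: (cvg_comp (fun zt => zt.2^-1) toCplx _ (@continuous_toCplx 0)).
  apply: (cvg_comp snd (fun t => t^-1)); first exact: cvg_snd.
  by apply/gtr0_cvgV0; [exact: nbhs_pinfty_gt | exact: cvg_id].
have cv : p.[zt.1] / E.[zt.1] * (v * toCplx zt.2^-1 + jw 1)^-1 @[zt --> F] -->
    - jw 1 * (p.[z0] / E.[z0]).
  have -> : - jw 1 * (p.[z0] / E.[z0]) = p.[z0] / E.[z0] * (jw 1)^-1 by rewrite jw1V mulrC.
  have cE := @cvgV _ _ F FF _ _ E0 (hornerF E).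
  have cj := @cvgV _ _ F FF _ _ jw1_neq0 cw.
  exact: (@cvgM _ _ F FF _ _ _ _ (@cvgM _ _ F FF _ _ _ _ (hornerF p) cE) cj).
have nE : \forall zt \near F, E.[zt.1] != 0 by exact: (@cvgr_neq0 _ _ _ F FF _ _ (hornerF E)).
have nw : \forall zt \near F, v * toCplx zt.2^-1 + jw 1 != 0.
  by apply: (@cvgr_neq0 _ _ _ F FF _ _ cw); exact: jw1_neq0.
have nt : \forall zt \near F, 0 < zt.2.
  exists (setT, [set t : R | 0 < t]) => /=; last by move=> zt [].
  by split; [exact: filterT | exact: nbhs_pinfty_gt].
have nN := cv _ NN.
suff : \forall zt \near F, first_quadrant zt.1 ->
    p.[zt.1] != (v + jw zt.2) * (('X - z0%:P) ^+ k * E).[zt.1] by [].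
near=> zt => zQ; apply/negP => /eqP pz.
have t0 : 0 < zt.2 by near: zt.
have E0' : E.[zt.1] != 0 by near: zt.
have w0 : v * toCplx zt.2^-1 + jw 1 != 0 by near: zt.
apply: (hN zt.1 zt.2) => //.
have -> : toCplx zt.2 * (zt.1 - z0) ^+ k = p.[zt.1] / E.[zt.1] * (v * toCplx zt.2^-1 + jw 1)^-1.
  have ct : toCplx zt.2 != 0 by rewrite fmorph_eq0 gt_eqF.
  rewrite pz hornerM horner_exp hornerXsubC jw_toCplx fmorphV.
  rewrite fmorphV in w0.
  have -> : v + toCplx zt.2 * jw 1 = toCplx zt.2 * (v / toCplx zt.2 + jw 1).
    by rewrite mulrDr mulrCA divff // mulr1.
  move: w0 ct; set w := _ + jw 1; set u := toCplx _ => w0 ct.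
  by rewrite !mulrA mulfK // (mulrAC u w) mulfK.
by near: zt; exact: nN.
Unshelve. all: by end_near. Qed.
End Quadrant.

(** * A maximum principle for rational functions on the quadrant *)

Section Max.
Variable R : realType.
Implicit Types (z s v : Cplx R) (p q : {poly Cplx R}) (t : R).

(** The value [a] of [p / q] at infinity is real and [v + jt] is not, so that the degree
    does not drop; this keeps the roots away from infinity. *)
Lemma size_level_poly p q (a : R) v t : (size (p - toCplx a *: q)%R < size q)%N ->
  0 < complex.Im v -> 0 <= t -> size (level_poly p q v t) = size q.
Proof.
move=> spq iv t0.
have c0 : toCplx a - (v + jw t) != 0.
  rewrite eq_complex /= !(Re_add, Im_add, Re_opp, Im_opp) /= sub0r oppr_eq0 negb_and orbC.
  by rewrite gt_eqF // ltr_wpDr.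
have -> : level_poly p q v t = (toCplx a - (v + jw t)) *: q + (p - toCplx a *: q).
  by rewrite /level_poly scalerBl [RHS]addrC addrA subrK.
by rewrite size_polyDl size_scale.
Qed.

Lemma level_poly_shift p q v t t' : level_poly p q v t' = level_poly p q v t + - jw (t' - t) *: q.
Proof.
rewrite /level_poly -addrA -!scaleNr -scalerDl; congr (_ + _ *: _).
by apply/eqP; rewrite eq_complex !(Re_add, Im_add, Re_opp, Im_opp) /=; apply/andP; split;
  apply/eqP; ring.
Qed.

Lemma near_jw_shift t e : 0 < e -> \forall t' \near t, `|- jw (t' - t) : Cplx R| < e.
Proof.
move=> /Cplx_gt0E[-> e0]; near=> t'.
rewrite normrN norm_jw ltr_toCplx distrC; near: t'.
by apply: (@cvgr_dist_lt _ _ _ (nbhs t) _ id).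
Unshelve. all: by end_near. Qed.

(** A value [v] in the upper half plane would make the set [T] below a
    nonempty, bounded, closed subset of the half line that is open to the right. *)
Lemma quadrant_avoids_upper_value p q (a : R) v :
  (size (p - toCplx a *: q)%R < size q)%N -> 0 < complex.Im v ->
  (forall z, root q z -> ~~ root p z) ->
  (forall z, first_quadrant z -> complex.Re z = 0 \/ complex.Im z = 0 -> ~~ root q z ->
     complex.Im (p.[z] / q.[z]) <= 0) ->
  (forall z, first_quadrant z -> root q z ->
     \forall s \near z & t \near +oo, first_quadrant s -> p.[s] != (v + jw t) * q.[s]) ->
  forall z, first_quadrant z -> p.[z] != v * q.[z].
Proof.
move=> spq iv cpq bnd poles z0 z0Q; apply/negP => /eqP z0v.
have q0 : q != 0 by rewrite -size_poly_gt0 (leq_trans _ spq).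
pose T : set R := [set t | 0 <= t /\ exists2 z, first_quadrant z & root (level_poly p q v t) z].
have T0 : T 0.
  split => //; exists z0 => //; rewrite root_level_poly z0v.
  by rewrite (_ : jw 0 = 0) ?addr0.
have lev0 t : 0 <= t -> level_poly p q v t != 0.
  by move=> t0; rewrite -size_poly_eq0 (size_level_poly spq) // size_poly_eq0.
have Tinf : \forall t \near +oo, ~ T t.
  have Hs : (size (p - v *: q)%R <= size q)%N.
    rewrite -(size_level_poly (v := v) (t := 0) spq) // /level_poly (_ : jw 0 = 0) ?addr0 //.
  have d0 e : 0 < e -> \forall t \near +oo, `|jw t^-1 : Cplx R| < e.
    move=> /Cplx_gt0E[-> e0]; near=> t.
    have t0 : 0 < t by near: t; exact: nbhs_pinfty_gt.
    rewrite norm_jw ltr_toCplx gtr0_norm ?invr_gt0 // invf_plt ?posrE //.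
    by near: t; apply: nbhs_pinfty_gt; rewrite num_real.
  (* Dividing by [- j t] turns [p - (v + jt) q] into the perturbation
     [q + (j / t) (p - v q)] of [q]. *)
  have := @roots_near _ _ (+oo : set_system R) _ q (p - v *: q) (fun t => jw t^-1)
    (fun t z => first_quadrant z -> p.[z] != (v + jw t) * q.[z]) q0 Hs d0.
  move=> H; near=> t; move=> [t0 [z zQ]]; rewrite root_level_poly => /eqP zt.
  have {}t0 : 0 < t by near: t; exact: nbhs_pinfty_gt.
  have : root (q + jw t^-1 *: (p - v *: q)) z.
    rewrite rootE !hornerE zt mulrDl addrAC subrr add0r mulrA.
    have -> : jw t^-1 * jw t = -1 :> Cplx R.
      rewrite (jw_toCplx t^-1) (jw_toCplx t) mulrACA -rmorphM mulVf ?gt_eqF //.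
      by rewrite rmorph1 mul1r jw1_sq.
    by rewrite mulN1r subrr.
  suff good : forall z, root (q + jw t^-1 *: (p - v *: q)) z ->
      first_quadrant z -> p.[z] != (v + jw t) * q.[z].
    by move=> /good /(_ zQ); rewrite zt eqxx.
  near: t; apply: H => r qr.
  have [rQ|rnQ] := pselect (first_quadrant r).
    have [[U V] [/= hU hV] UV] := poles r rQ qr.
    by exists (U, V) => // -[s t] /= st _; apply: (UV (s, t)).
  have hU : \forall s \near r, ~ first_quadrant s by apply: near_notin_quadrant.
  exists ([set s | ~ first_quadrant s], setT) => /=; first by split => //; exact: filterT.
  by move=> [s t] [/= ns _] _ /ns.
have hsT : has_sup T.
  split; first by exists 0.
  have [M [_ hM]] := Tinf.
  by exists M => t Tt; rewrite leNgt; apply/negP => /hM; apply.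
pose tau := sup T.
have tau0 : 0 <= tau by apply: ub_le_sup => //; exact: (proj2 hsT).
have ltau := lev0 _ tau0.
have sl : (size q <= size (level_poly p q v tau))%N by rewrite (size_level_poly spq).
have [_ [z1 z1Q z1tau]] : T tau.
  apply: contrapT => nT.
  have hfar : \forall t \near tau, forall z, root (level_poly p q v t) z -> ~ first_quadrant z.
    have := @roots_near _ _ (nbhs tau) _ (level_poly p q v tau) q (fun t => - jw (t - tau))
       (fun _ z => ~ first_quadrant z) ltau sl (near_jw_shift tau).
    move=> H; near=> t => z; rewrite (level_poly_shift _ _ _ tau); move: z; near: t; apply: H.
    move=> r rr; have rnQ : ~ first_quadrant r by move=> rQ; apply: nT; split => //; exists r.
    exists ([set s | ~ first_quadrant s], setT) => /=; last by move=> [s t] [].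
    by split; [exact: near_notin_quadrant | exact: filterT].
  have /nbhs_ballP[e /= e0 he] := hfar.
  have [t Tt tlt] := sup_adherent e0 hsT.
  have tle : t <= tau by apply: ub_le_sup => //; exact: (proj2 hsT).
  case: Tt => t0 [z zQ rz]; apply: (he t _ z) => //.
  by rewrite /ball /= ger0_norm ?subr_ge0 // ltrBlDr -ltrBlDl.
have qz1 : ~~ root q z1.
  apply/negP => qz1; move/negP: (cpq _ qz1); apply.
  by move: z1tau; rewrite root_level_poly (eqP (qz1 : q.[z1] == 0)) mulr0.
have val1 : p.[z1] / q.[z1] = v + jw tau.
  by move: z1tau; rewrite root_level_poly => /eqP ->; rewrite mulfK.
have z1pos : 0 < complex.Re z1 /\ 0 < complex.Im z1.
  have nb : ~ (complex.Re z1 = 0 \/ complex.Im z1 = 0).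
    move=> b; have := bnd _ z1Q b qz1; rewrite val1 Im_add /= leNgt.
    by rewrite ltr_wpDr.
  by case: z1Q => re im; rewrite !lt_neqAle re im !andbT; split; apply/eqP => E;
    apply: nb; [left | right].
have /nbhs_normP[e /= e0 he] := near_interior_quadrant z1pos.1 z1pos.2.
have pers : \forall t \near tau, exists2 w,
    root (level_poly p q v tau + - jw (t - tau) *: q) w & `|w - z1| < e.
  exact: (@root_persists _ _ (nbhs tau) _ (level_poly p q v tau) q (fun t => - jw (t - tau)) z1 e
   ltau sl (near_jw_shift tau) z1tau e0).
have [r /= r0 hr] := proj1 (nbhs_ballP _ _) pers.
have Tbig : T (tau + r / 2).
  split; first by rewrite addr_ge0 // ltW // divr_gt0.
  have [|w rw wz] := hr (tau + r / 2).
    rewrite /ball /= opprD addrA subrr sub0r normrN gtr0_norm ?divr_gt0 //.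
    by rewrite ltr_pdivrMr // ltr_pMr // ltr1n.
  exists w; first by apply: he; rewrite /= distrC.
  by rewrite (level_poly_shift _ _ _ tau).
have : tau + r / 2 <= tau by apply: ub_le_sup => //; exact: (proj2 hsT).
by rewrite gerDl leNgt divr_gt0.
Unshelve. all: by end_near. Qed.
End Max.

(** * Fractions in lowest terms and transfer functions *)

Section Fractions.
Variable R : realType.
Implicit Types (f : {fraction {poly R}}) (P Q : {poly R}).

Lemma frac_repr f : f * tofrac (frac (repr f)).2 = tofrac (frac (repr f)).1.
Proof.
rewrite -{1}(reprK f); set r := repr f; unlock tofrac.
rewrite -[LHS]FracField.pi_mul; apply/eqmodP => /=.
by rewrite FracField.equivfE /FracField.mulf !numden_Ratio ?mulf_neq0 ?oner_neq0 ?denom_ratioP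
   ?mulr1 // mulrC.
Qed.

Lemma gcd_frac_neq0 f : gcdp (frac (repr f)).1 (frac (repr f)).2 != 0.
Proof. by rewrite gcdp_eq0 negb_and (denom_ratioP (repr f)) orbT. Qed.

Lemma rden_neq0 f : rden f != 0.
Proof. by rewrite /rden dvdp_div_eq0 ?dvdp_gcdr // denom_ratioP. Qed.

Lemma coprimep_rnum_rden f : coprimep (rnum f) (rden f).
Proof. by rewrite coprimep_div_gcd // (denom_ratioP (repr f)) orbT. Qed.

(** The reduced form of [f] can be compared with any other way of writing it as a
    fraction, such as the one coming from the characteristic polynomial. *)
Lemma rnum_rden_cross f P Q : Q != 0 -> f = tofrac P / tofrac Q ->
  rnum f * Q = P * rden f.
Proof.
move=> Q0 fE; have g0 := gcd_frac_neq0 f.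
have dE : rden f * gcdp (frac (repr f)).1 (frac (repr f)).2 = (frac (repr f)).2.
  by rewrite divpK // dvdp_gcdr.
have nE : rnum f * gcdp (frac (repr f)).1 (frac (repr f)).2 = (frac (repr f)).1.
  by rewrite divpK // dvdp_gcdl.
have E := frac_repr f.
apply: (mulIf g0); apply/eqP; rewrite -tofrac_eq; apply/eqP.
have tQ : tofrac Q != 0 by rewrite tofrac_eq0.
by rewrite mulrAC nE -(mulrA P) dE !tofracM -E {1}fE mulrAC divfK.
Qed.
End Fractions.

Section Transfer.
Variable R : realType.
Variable n : nat.
Implicit Types (A : 'M[R]_n) (B : 'cV[R]_n) (C : 'rV[R]_n) (D eps : R).

(** Numerator of the strictly proper part over [char_poly A], by Cramer's rule. *)
Definition adj_num A B C : {poly R} :=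
  (map_mx polyC C *m \adj (char_poly_mx A) *m map_mx polyC B) 0 0.

Lemma tofrac_affine (K : idomainType) (a d x : K) : x != 0 ->
  tofrac (a + d * x) / tofrac x = (tofrac x)^-1 * tofrac a + tofrac d.
Proof. by move=> x0; rewrite tofracD tofracM mulrDl mulfK ?tofrac_eq0 // [X in X + _]mulrC. Qed.

Lemma transfer_functionE A B C D : transfer_function A B C D%:M 0 0 =
  tofrac (adj_num A B C + D%:P * char_poly A) / tofrac (char_poly A).
Proof.
have chi0 : tofrac (char_poly A) != 0 by rewrite tofrac_eq0 monic_neq0 ?char_poly_monic.
have cE m k (M : 'M[R]_(m, k)) : map_mx (@rat_const R) M = map_mx (@tofrac _) (map_mx polyC M).
  by apply/matrixP => i j; rewrite !mxE.
have XA : (tofrac 'X)%:M - map_mx (@rat_const R) A = map_mx (@tofrac _) (char_poly_mx A).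
  by rewrite map_mxB map_scalar_mx cE.
have U : map_mx (@tofrac _) (char_poly_mx A) \in unitmx by rewrite unitmxE det_map_mx unitfE.
rewrite /transfer_function XA /invmx U det_map_mx -map_mx_adj !cE.
rewrite -scalemxAr -scalemxAl -!map_mxM !mxE eqxx mulr1n.
rewrite [\sum_j _](_ : _ = adj_num A B C); last by rewrite /adj_num mxE.
by rewrite (tofrac_affine _ _ (monic_neq0 (char_poly_monic A))).
Qed.

(** Leibniz formula: each term is a product of [m] factors of degree at most 1. *)
Lemma size_det_le m (M : 'M[{poly R}]_m) :
  (forall i j, (size (M i j) <= 2)%N) -> (size (\det M) <= m.+1)%N.
Proof.
move=> sM; apply: (leq_trans (size_sum _ _ _)); apply/bigmax_leqP => s _.
rewrite -signr_odd mulr_sign; rewrite (fun_if (fun p : {poly R} => size p)) size_polyN if_same.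
apply: leq_trans (size_prod_leq _ _) _.
rewrite card_ord leq_subLR addnS ltnS.
apply: (@leq_trans (\sum_(i < m) 2)%N); first by apply: leq_sum => i _; exact: sM.
by rewrite sum_nat_const card_ord muln2 addnn.
Qed.
Lemma size_adj_num A B C : (size (adj_num A B C) <= n)%N.
Proof.
rewrite /adj_num mxE; apply: (leq_trans (size_sum _ _ _)); apply/bigmax_leqP => j _.
rewrite !mxE mulrC mul_polyC; apply: leq_trans (size_scale_leq _ _) _.
apply: (leq_trans (size_sum _ _ _)); apply/bigmax_leqP => i _.
rewrite !mxE mul_polyC; apply: leq_trans (size_scale_leq _ _) _.
rewrite /cofactor -signr_odd mulr_sign.
rewrite (fun_if (fun p : {poly R} => size p)) size_polyN if_same.
have n0 : (0 < n)%N by case: (n) i => [[]|].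
apply: leq_trans (size_det_le _) _; last by rewrite prednK.
move=> k l; rewrite !mxE; apply: leq_trans (size_polyD _ _) _.
rewrite geq_max size_polyN (leq_trans (size_polyC_leq1 _)) // andbT.
by case: (_ == _); rewrite ?mulr1n ?mulr0n ?size_polyX ?size_poly0.
Qed.

(** [sI - (A - eps I) = (s + eps) I - A]. *)
Lemma char_poly_mx_shift A eps :
  char_poly_mx (A - eps%:M) = map_mx (comp_poly ('X + eps%:P)) (char_poly_mx A).
Proof.
apply/matrixP => i j; rewrite !mxE comp_polyB comp_polyC.
case: (i == j); rewrite ?mulr1n ?mulr0n; last by rewrite comp_poly0 subr0.
by rewrite comp_polyX polyCB opprB addrA addrAC.
Qed.

Lemma char_poly_shift A eps : char_poly (A - eps%:M) = char_poly A \Po ('X + eps%:P).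
Proof. by rewrite /char_poly char_poly_mx_shift det_map_mx. Qed.

Lemma adj_num_shift A B C eps :
  adj_num (A - eps%:M) B C = adj_num A B C \Po ('X + eps%:P).
Proof.
have cE m k (M : 'M[R]_(m, k)) :
    map_mx polyC M = map_mx (comp_poly ('X + eps%:P)) (map_mx polyC M).
  by apply/matrixP => i j; rewrite !mxE comp_polyC.
by rewrite /adj_num char_poly_mx_shift -map_mx_adj (cE _ _ B) (cE _ _ C) -!map_mxM mxE -!cE.
Qed.

Variables (A : 'M[R]_n) (B : 'cV[R]_n) (C : 'rV[R]_n) (D : R).
Let f := transfer_function A B C D%:M 0 0.

(** [G - D] is strictly proper, hence [G] has the real value [D] at infinity; this
    survives the cancellation of common factors. *)
Lemma transfer_function_proper : (size (rnum f - D *: rden f)%R < size (rden f))%N.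
Proof.
have chi0 : char_poly A != 0 by rewrite monic_neq0 ?char_poly_monic.
have E : (rnum f - D *: rden f) * char_poly A = adj_num A B C * rden f.
  rewrite mulrBl (rnum_rden_cross chi0 (transfer_functionE A B C D)) mulrDl.
  by rewrite -mul_polyC -/f (mulrAC _ (rden f)) addrK.
have [->|h0] := eqVneq (rnum f - D *: rden f) 0.
  by rewrite size_poly0 size_poly_gt0 rden_neq0.
have a0 : adj_num A B C != 0.
  by apply: contraNneq (mulf_neq0 h0 chi0) => a0; rewrite E a0 mul0r.
have := congr1 (fun g : {poly R} => size g) E.
rewrite !size_mul ?rden_neq0 // size_char_poly addnS /= => sE.
have := size_adj_num A B C; have : (0 < size (adj_num A B C))%N by rewrite size_poly_gt0.
move: sE; move: (size _) (size _) (size _) => x y z; lia.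
Qed.

(** [G_eps(s) = G(s + eps)], as an identity between cross products of the
    reduced fractions. *)
Lemma transfer_function_shift eps :
  let fe := transfer_function (A - eps%:M) B C D%:M 0 0 in
  rnum fe * (rden f \Po ('X + eps%:P)) = (rnum f \Po ('X + eps%:P)) * rden fe.
Proof.
move=> fe.
have chi0 (M : 'M[R]_n) : char_poly M != 0 by rewrite monic_neq0 ?char_poly_monic.
have E := rnum_rden_cross (chi0 _) (transfer_functionE A B C D).
have Ee := rnum_rden_cross (chi0 _) (transfer_functionE (A - eps%:M) B C D).
have {E} := congr1 (comp_poly ('X + eps%:P)) E.
rewrite !rmorphM /= rmorphD rmorphM /= comp_polyC -adj_num_shift -char_poly_shift -/f => E.
apply: (mulIf (chi0 (A - eps%:M))).
by rewrite mulrAC Ee -/fe mulrAC [RHS]mulrAC E mulrAC.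
Qed.
End Transfer.

(** * Scalar negative imaginary functions *)

Section Scalar.
Variable R : realType.
Implicit Types (G : 'M[{fraction {poly R}}]_1) (f : {fraction {poly R}}) (s z : Cplx R).
Local Notation num f := (map_poly (@toCplx R) (rnum f)).
Local Notation den f := (map_poly (@toCplx R) (rden f)).

Lemma den_neq0 f : den f != 0.
Proof. by rewrite map_poly_eq0 rden_neq0. Qed.

Lemma den_root_num f s : root (den f) s -> ~~ root (num f) s.
Proof.
have /coprimep_root : coprimep (den f) (num f).
  by rewrite coprimep_map coprimep_sym coprimep_rnum_rden.
exact.
Qed.

Lemma pole_order_scalar G s : pole_order G s = rpole_order (G 0 0) s.
Proof. by rewrite /pole_order !big_ord_recl !big_ord0 !maxn0. Qed.

Lemma is_pole_scalar G s : is_pole G s <-> root (den (G 0 0)) s.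
Proof. by rewrite /is_pole pole_order_scalar /rpole_order -XsubC_dvd ?den_neq0 // dvdp_XsubCl. Qed.

Lemma psdmx_scalar (M : 'M[Cplx R]_1) : psdmx M <-> 0 <= M 0 0.
Proof.
split=> [[_ /(_ 1%:M)]|M0].
  by rewrite mulmx1 trmx1 map_mx1 mul1mx.
split.
  by apply/matrixP => i j; rewrite !mxE !ord1; apply: CrealP; exact: ger0_real.
move=> x; rewrite !mxE big_ord_recl big_ord0 addr0 !mxE big_ord_recl big_ord0 addr0 !mxE.
by rewrite mulrAC mulrC mulr_ge0 // mulrC mul_conjC_ge0.
Qed.

(** A complex number minus its conjugate, times [j], is [- 2] times its imaginary
    part. *)
Lemma psdmx_imaginary (M : 'M[Cplx R]_1) :
  psdmx (jw 1 *: (M - map_mx Num.conj (M^T))) <-> complex.Im (M 0 0) <= 0.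
Proof.
rewrite psdmx_scalar !mxE; case: (M 0 0) => a b; rewrite lecE /=.
rewrite !mul0r !mul1r sub0r opprK subrr addr0 eqxx /=.
by split=> h; lra.
Qed.

Lemma horner_map_shift P (eps : R) s :
  (map_poly (@toCplx R) (P \Po ('X + eps%:P))).[s] = (map_poly (@toCplx R) P).[s + toCplx eps].
Proof. by rewrite map_comp_poly horner_comp rmorphD /= map_polyX map_polyC !hornerE. Qed.

Lemma horner_real (P : {poly R}) x : (map_poly (@toCplx R) P).[toCplx x] = toCplx P.[x].
Proof. exact: horner_map. Qed.

Lemma cancel_factor (F : fieldType) (x c a b : F) : x != 0 ->
  x * (c * (a / (x * b))) = c * (a / b).
Proof. by move=> x0; rewrite invfM (mulrCA a) (mulrCA c) mulVKf. Qed.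

(** Reads the limits in the pole conditions as leading coefficients: after
    cancellation of [(s - z)^k] the function is continuous at [z]. *)
Lemma leading_coefficient_unique (p E : {poly Cplx R}) (k : nat) z (c L : Cplx R) :
  E.[z] != 0 ->
  ((s - z) ^+ k * (c * (p.[s] / (('X - z%:P) ^+ k * E).[s]))) @[s --> z^'] --> L ->
  L = c * (p.[z] / E.[z]).
Proof.
move=> E0 hL.
have PF := @Proper_dnbhs_numFieldType (Cplx R) z.
have FF : Filter (z^') by exact: PF.
have FN := nbhs_filter z.
have cc : c @[_ --> nbhs z] --> c by exact: cvg_cst.
have cE := @cvgM _ _ _ FN _ _ _ _ cc (@cvgM _ _ _ FN _ _ _ _
  (@continuous_hornerC _ p z) (@cvgV _ _ _ FN _ _ E0 (@continuous_hornerC _ E z))).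
have cE' := @cvg_within_filter _ _ _ (nbhs z) FN _ [set s | s != z] cE.
have eqE : \forall s \near z^', (s - z) ^+ k * (c * (p.[s] / (('X - z%:P) ^+ k * E).[s])) =
    c * (p.[s] / E.[s]).
  near=> s.
  have sz : s - z != 0 by rewrite subr_eq0; near: s; exact: nbhs_dnbhs_neq.
  by rewrite hornerM horner_exp hornerXsubC cancel_factor // expf_neq0.
have hL' := cvg_trans (@near_eq_cvg _ _ _ FF _ _ eqE) hL.
exact: (@norm_cvg_unique _ (Cplx R) _ (fmap_proper_filter _ PF) _ _ hL' cE').
Unshelve. all: by end_near. Qed.
End Scalar.

Section NegativeImaginary.
Variable R : realType.
Implicit Types (G : 'M[{fraction {poly R}}]_1) (f : {fraction {poly R}}) (s z v : Cplx R).
Local Notation num f := (map_poly (@toCplx R) (rnum f)).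
Local Notation den f := (map_poly (@toCplx R) (rden f)).

Lemma nbhs_Re_lt0 z : complex.Re z < 0 -> nbhs z [set y | complex.Re y < 0].
Proof. exact: (@cvgr_lt _ _ (nbhs z) (nbhs_filter z) _ _ (@continuous_Re R z)). Qed.

Lemma nbhs_Im_lt0 z : complex.Im z < 0 -> nbhs z [set y | complex.Im y < 0].
Proof. exact: (@cvgr_lt _ _ (nbhs z) (nbhs_filter z) _ _ (@continuous_Im R z)). Qed.

Lemma den_factor f z : exists2 E : {poly Cplx R},
  den f = ('X - z%:P) ^+ rpole_order f z * E & E.[z] != 0.
Proof.
have [m [E Ez dE]] := multiplicity_XsubC (den f) z.
rewrite den_neq0 /= in Ez.
exists E => //; rewrite /rpole_order dE mupMr // mup_XsubCX eqxx.
by rewrite mulrC.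
Qed.

Lemma leading_matrix_coefficient G (E : {poly Cplx R}) (k : nat) z c (K0 : 'M[Cplx R]_1)
    (F : Cplx R -> 'M[Cplx R]_1) :
  den (G 0 0) = ('X - z%:P) ^+ k * E -> E.[z] != 0 ->
  (forall s, F s = (s - z) ^+ k *: (c *: tf_eval G s)) ->
  F s @[s --> z^'] --> K0 -> K0 0 0 = c * ((num (G 0 0)).[z] / E.[z]).
Proof.
move=> dE E0 FE hF; apply: (@leading_coefficient_unique R _ E k) => //.
have hF0 := cvg_comp F (fun M : 'M[Cplx R]_1 => M 0 0) hF (@coord_continuous _ 1 1 0 0 K0).
have -> : (fun s => (s - z) ^+ k * (c * ((num (G 0 0)).[s] / (('X - z%:P) ^+ k * E).[s]))) =
   (fun s => F s 0 0); last exact: hF0.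
by apply/funext => s; rewrite FE !mxE /reval dE.
Qed.

(** Poles in the closed quadrant are on the imaginary axis, since the open right half plane
    contains none. *)
Lemma den_root_boundary G z : negative_imaginary G -> first_quadrant z ->
  root (den (G 0 0)) z -> exists2 w, 0 <= w & z = jw w.
Proof.
move=> [h1 _ _ _] [re im] rz; exists (complex.Im z) => //.
have : ~ 0 < complex.Re z by move=> /h1; apply; apply/is_pole_scalar.
move/negP; rewrite -leNgt => re'.
have {re re'} re0 : complex.Re z = 0 by apply/eqP; rewrite eq_le re re'.
by apply/eqP; rewrite eq_complex /= re0 !eqxx.
Qed.

Lemma ni_axis_le0 G w : negative_imaginary G -> 0 <= w -> ~~ root (den (G 0 0)) (jw w) ->
  complex.Im (reval (G 0 0) (jw w)) <= 0.
Proof.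
move=> [_ h2 _ _] w0 nr.
have /h2/psdmx_imaginary : ~ is_pole G (jw w) by move=> /is_pole_scalar; apply/negP.
by rewrite mxE; apply.
Qed.

Lemma reval_real f x : complex.Im (reval f (toCplx x)) = 0.
Proof. by rewrite /reval !horner_real -fmorphV -rmorphM. Qed.

Lemma coefficient_neq0 f z (E : {poly Cplx R}) : root (den f) z -> E.[z] != 0 ->
  (num f).[z] / E.[z] != 0.
Proof. by move=> /den_root_num nz E0; rewrite mulf_neq0 ?invr_eq0. Qed.

(** The sign of the residue [c] comes from the behaviour of [G] on the imaginary
    axis near 0.  It is real because [G] has real coefficients, and it is
    nonnegative because [c] is the limit of [jw G(jw)], whose real part
    [- w Im G(jw)] is nonnegative by the condition on the imaginary axis. *)
Lemma simple_pole_origin G (E : {poly Cplx R}) : negative_imaginary G ->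
  den (G 0 0) = ('X - 0%:P) ^+ 1 * E -> E.[0] != 0 ->
  let c := (num (G 0 0)).[0] / E.[0] in complex.Im c = 0 /\ 0 <= complex.Re c.
Proof.
move=> hNI; rewrite expr1 subr0 => dE E0 c.
have r0 : root (rden (G 0 0)) 0.
  have : root (den (G 0 0)) (toCplx 0) by rewrite rmorph0 dE rootM rootX eqxx.
  by rewrite fmorph_root.
have [E' rE'] := factor_theorem _ _ r0.
have EE : E = map_poly (@toCplx R) E'.
  apply: (@mulfI _ 'X); first by rewrite polyX_eq0.
  by rewrite -dE rE' subr0 rmorphM /= map_polyX mulrC.
split.
  by rewrite /c EE -(rmorph0 (@toCplx R)) !horner_real -fmorphV -rmorphM.
rewrite leNgt; apply/negP => c0.
have FN := nbhs_filter (0 : Cplx R).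
have cc : (num (G 0 0)).[s] / E.[s] @[s --> nbhs (0 : Cplx R)] --> c.
  exact: (@cvgM _ _ _ FN _ _ _ _ (@continuous_hornerC _ (num (G 0 0)) 0)
    (@cvgV _ _ _ FN _ _ E0 (@continuous_hornerC _ E 0))).
have N1 : \forall s \near (0 : Cplx R), complex.Re ((num (G 0 0)).[s] / E.[s]) < 0.
  exact: cc (nbhs_Re_lt0 c0).
have N2 : \forall s \near (0 : Cplx R), E.[s] != 0.
  exact: (@cvgr_neq0 _ _ _ _ FN _ _ (@continuous_hornerC _ E 0)).
have /nbhs_normP[e /= /Cplx_gt0E[-> e0] he] : \forall s \near (0 : Cplx R),
    complex.Re ((num (G 0 0)).[s] / E.[s]) < 0 /\ E.[s] != 0.
  by near=> s; split; near: s.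
set w := complex.Re e / 2.
have w0 : 0 < w by rewrite divr_gt0.
have [|Rneg Ew] := he (jw w).
  rewrite /= sub0r normrN norm_jw ltr_toCplx gtr0_norm //.
  by rewrite ltr_pdivrMr // ltr_pMr // ltr1n.
have jw0 : jw w != 0 :> Cplx R by rewrite eq_complex /= (gt_eqF w0) andbF.
have nr : ~~ root (den (G 0 0)) (jw w).
  by rewrite dE rootE hornerM hornerX mulf_neq0.
have := ni_axis_le0 hNI (ltW w0) nr.
have : complex.Re (jw w * reval (G 0 0) (jw w)) < 0.
  move: Rneg; rewrite /reval dE hornerM hornerX.
  by rewrite invfM (mulrCA (horner _ _)) mulVKf.
rewrite Re_mul /= mul0r sub0r oppr_lt0 => h h'.
by move: h; rewrite ltNge mulr_ge0_le0 // ltW.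
Unshelve. all: by end_near. Qed.

(** With [c] the leading coefficient of the pole [z] and [k] its order, the sign
    conditions are as follows, for [s] in the quadrant.
    - [z = jw] with [w > 0]: [k = 1] and [j c > 0], so [Re (- j c) < 0], whereas
      [Re (s - z) >= 0].
    - [z = 0]: [c > 0], so [Im (- j c) < 0], whereas both [Im s] and [Im s^2] are
      nonnegative. *)
Lemma ni_pole_avoids_ray G v z : negative_imaginary G -> first_quadrant z ->
  root (den (G 0 0)) z ->
  \forall s \near z & t \near +oo, first_quadrant s ->
    (num (G 0 0)).[s] != (v + jw t) * (den (G 0 0)).[s].
Proof.
move=> hNI zQ rz; have [w w0 zw] := den_root_boundary hNI zQ rz.
have pz : is_pole G z by apply/is_pole_scalar.
have [E dE E0] := den_factor (G 0 0) z.
have c0 := coefficient_neq0 rz E0.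
set c := _ / _ in c0.
move: w0; rewrite le_eqVlt => /predU1P[w0|w0].
- have z0 : z = 0 by rewrite zw -w0.
  clear zw; subst z.
  have [_ _ _ h4] := hNI.
  have cpos : complex.Im c = 0 -> 0 <= complex.Re c -> complex.Im (- jw 1 * c) < 0.
    move=> imc rec; rewrite Im_mul Re_opp Im_opp /= imc mulr0 add0r mulN1r oppr_lt0.
    rewrite lt_neqAle rec andbT.
    by move: c0; rewrite eq_complex imc eqxx andbT eq_sym.
  have [[po|po] hK] := h4 pz.
    rewrite pole_order_scalar in po; rewrite po in dE *.
    have [] := @simple_pole_origin G E hNI dE E0; rewrite -/c => imc rec.
    apply: (pole_avoids_ray (p := num (G 0 0)) v dE E0 (nbhs_Im_lt0 (cpos imc rec))) => //.
    move=> s t [_ ims] t0 /=; rewrite subr0 expr1 Im_mul /= mul0r addr0.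
    by apply/negP; rewrite -leNgt mulr_ge0 // ltW.
  have [K cK /psdmx_scalar] := hK po.
  rewrite pole_order_scalar in po; rewrite po in dE *.
  rewrite (@leading_matrix_coefficient G E 2 0 1 K (fun s => s ^+ 2 *: tf_eval G s)) //; last first.
    by move=> s; rewrite subr0 scale1r.
  rewrite mul1r -/c lecE /= => /andP[/eqP imc rec].
  apply: (pole_avoids_ray (p := num (G 0 0)) v dE E0 (nbhs_Im_lt0 (cpos imc rec))) => //.
  move=> s t [res ims] t0 /=; rewrite subr0 expr2 Im_mul /= mul0r addr0 Im_mul.
  by apply/negP; rewrite -leNgt mulr_ge0 ?addr_ge0 ?mulr_ge0 // ltW.
- have [_ _ h3 _] := hNI.
  have [|po [K cK /psdmx_scalar]] := h3 w w0; first by rewrite -zw.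
  rewrite -zw in po cK; rewrite pole_order_scalar in po; rewrite po in dE *.
  rewrite (@leading_matrix_coefficient G E 1 z (jw 1) K
     (fun s => (s - z) *: (jw 1 *: tf_eval G s))) // -/c lecE => /andP[imc rec].
  have lt0 : complex.Re (- jw 1 * c) < 0.
    rewrite mulNr Re_opp oppr_lt0 lt_neqAle rec andbT.
    have : jw 1 * c != 0 by rewrite mulf_neq0 ?jw1_neq0.
    by rewrite eq_complex imc andbT eq_sym.
  apply: (pole_avoids_ray (p := num (G 0 0)) v dE E0 (nbhs_Re_lt0 lt0)).
  move=> s t [res _] t0 /=; rewrite expr1 Re_mul Re_add Re_opp zw /= mul0r subr0 oppr0 addr0.
  by apply/negP; rewrite -leNgt mulr_ge0 // ltW.
Qed.

(** The maximum principle applied to [G]: on the real axis [G] is real, on the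
    imaginary axis [Im G <= 0] by definition, and the poles are controlled by
    [ni_pole_avoids_ray]. *)
Lemma ni_quadrant_le0 G (d : R) z : negative_imaginary G ->
  (size (rnum (G 0 0) - d *: rden (G 0 0))%R < size (rden (G 0%R 0%R)))%N ->
  first_quadrant z -> ~~ root (den (G 0 0)) z -> complex.Im (reval (G 0 0) z) <= 0.
Proof.
move=> hNI proper zQ nr; rewrite leNgt; apply/negP => im.
suff : (num (G 0 0)).[z] != reval (G 0 0) z * (den (G 0 0)).[z].
  by rewrite /reval divfK ?eqxx.
apply: (@quadrant_avoids_upper_value R _ _ d) => //.
- rewrite -mul_polyC -map_polyC /= -rmorphM -rmorphB /= !size_map_poly mul_polyC //.
- by move=> s; exact: den_root_num.
- move=> s sQ [] s0 ns.
    have sE : s = jw (complex.Im s) by apply/eqP; rewrite eq_complex /= s0 !eqxx.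
    by rewrite sE; apply: ni_axis_le0 => //; [case: sQ | rewrite -sE].
  have sE : s = toCplx (complex.Re s) by apply/eqP; rewrite eq_complex /= s0 !eqxx.
  by have := reval_real (G 0 0) (complex.Re s); rewrite -sE => ->.
- by move=> s sQ rs; exact: ni_pole_avoids_ray.
Qed.
End NegativeImaginary.

(** * The shifted transfer function *)

(** Since both fractions are reduced, a root [s] of [rden fe] would have to be a root
    of [rnum fe] too, unless [s + eps] is a pole of [f]. *)
Lemma reval_shift (R : realType) (f fe : {fraction {poly R}}) (eps : R) (s : Cplx R) :
  rnum fe * (rden f \Po ('X + eps%:P)) = (rnum f \Po ('X + eps%:P)) * rden fe ->
  ~~ root (map_poly toCplx (rden f)) (s + toCplx eps) ->
  ~~ root (map_poly toCplx (rden fe)) s /\ reval fe s = reval f (s + toCplx eps).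
Proof.
move=> cross nr.
have E := congr1 (fun g : {poly R} => (map_poly toCplx g).[s]) cross.
rewrite /= !rmorphM !hornerM !horner_map_shift in E.
have nre : ~~ root (map_poly toCplx (rden fe)) s.
  apply/negP => rs; have /negP := den_root_num rs; apply.
  by move/eqP: E; rewrite (eqP (rs : _.[s] == 0)) mulr0 mulf_eq0 (negPf (nr : _.[_] != 0)) orbF.
by split=> //; apply/eqP; rewrite /reval eqr_div // E.
Qed.

Unset Implicit Arguments.

Theorem mainTheorem2 (R : realType) (n : nat)
    (G : 'M[{fraction {poly R}}]_1)
    (A : 'M[R]_n) (B : 'cV[R]_n) (C : 'rV[R]_n) (D : R)
    (hmin : minimal_realization G A B C D%:M)
    (hNI : negative_imaginary G)
    (eps : R) (heps : 0 <= eps) :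
  negative_imaginary (transfer_function (A - eps%:M) B C D%:M).
Proof.
have [GE _] := hmin; rewrite /realization in GE.
have [e0|e0] := eqVneq eps 0; first by rewrite e0 raddf0 subr0 -GE.
have {heps e0} e0 : 0 < eps by rewrite lt_neqAle eq_sym e0.
have shifted (s : Cplx R) : 0 <= complex.Re s ->
    ~ is_pole (transfer_function (A - eps%:M) B C D%:M) s /\
    ~~ root (map_poly toCplx (rden (G 0 0))) (s + toCplx eps) /\
    reval (transfer_function (A - eps%:M) B C D%:M 0 0) s = reval (G 0 0) (s + toCplx eps).
  move=> s0; have nr : ~~ root (map_poly toCplx (rden (G 0 0))) (s + toCplx eps).
    apply/negP => /is_pole_scalar; case: hNI => + _ _ _; apply.
    by rewrite Re_add /= ltr_wpDl.
  rewrite GE in nr *; have [nre vE] := reval_shift (transfer_function_shift A B C D eps) nr.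
  by split=> //; move/is_pole_scalar; apply/negP.
split.
- by move=> s /ltW /shifted[].
- move=> w w0 _; apply/psdmx_imaginary; rewrite mxE.
  have [_ [nr ->]] := shifted (jw w) (lexx 0).
  apply: (ni_quadrant_le0 hNI (d := D)) => //.
    by rewrite GE; exact: transfer_function_proper.
  by split; rewrite !(Re_add, Im_add) /= ?add0r ?addr0 // ltW.
- by move=> w _ p; have [/(_ p)] := shifted (jw w) (lexx 0).
- by move=> p; have [/(_ p)] := shifted 0 (lexx 0).
Qed.
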